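(* Let $M:\mathbb{R}_+^2\to\mathbb{R}$ be a continuous, symmetric, homogeneous mean and let $m$ be its Seiffert function. Then $M$ admits a harmonic representation if and only if there exists a continuous Seiffert function $n:(0,1)\to\mathbb{R}$ such that $m=I(n)$, i.e. $m(z)=\int_0^z\frac{n(u)}{u}\,du$ for all $0<z<1$.
   Context: $\mathbb{R}_+=(0,\infty)$. A mean is a function $M:\mathbb{R}_+^2\to\mathbb{R}$ with $\min(x,y)\le M(x,y)\le\max(x,y)$ for all $x,y>0$; it is symmetric if $M(x,y)=M(y,x)$ and homogeneous if $M(\lambda x,\lambda y)=\lambda M(x,y)$ for all $\lambda>0$. All means considered are symmetric and homogeneous. A Seiffert function is a function $f:(0,1)\to\mathbb{R}$ satisfying $\frac{z}{1+z}\le f(z)\le\frac{z}{1-z}$ for all $0<z<1$. The Seiffert function of a symmetric homogeneous mean $M$ is $f_M(z)=\frac{z}{M(1-z,1+z)}$, $0<z<1$; then $M(x,y)=\frac{|x-y|}{2f_M\left(\frac{|x-y|}{x+y}\right)}$ for $x\ne y$, and $M\leftrightarrow f_M$ is a one-to-one correspondence between symmetric homogeneous means and Seiffert functions. For a continuous Seiffert function $f$, $I(f)(z)=\int_0^z\frac{f(u)}{u}\,du$ for $0<z<1$. For a mean $N$ and $0\le t\le 1$, $N^{\{t\}}(x,y)=N\left(\frac{x+y}{2}+t\frac{x-y}{2},\frac{x+y}{2}-t\frac{x-y}{2}\right)$. A continuous (symmetric, homogeneous) mean $N$ is a harmonic representation of a mean $M$ if $\frac{1}{M(x,y)}=\int_0^1\frac{dt}{N^{\{t\}}(x,y)}$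 for all $x,y>0$. $M$ admits a harmonic representation if such an $N$ exists. *)

(* Defs.v *)
From Stdlib Require Import Reals.
From Coquelicot Require Import Coquelicot.
Open Scope R_scope.

(* Functions on (0,oo)^2 and on (0,1) are total functions on R, of which only
   the values on those domains are ever used. *)

Definition is_mean (M : R -> R -> R) : Prop :=
  forall x y : R, 0 < x -> 0 < y -> Rmin x y <= M x y <= Rmax x y.

Definition is_symmetric (M : R -> R -> R) : Prop :=
  forall x y : R, 0 < x -> 0 < y -> M x y = M y x.

Definition is_homogeneous (M : R -> R -> R) : Prop :=
  forall l x y : R, 0 < l -> 0 < x -> 0 < y -> M (l * x) (l * y) = l * M x y.

(* As (0,oo)^2 is open in R^2, continuity on it is continuity at its points. *)
Definition is_continuous_mean (M : R -> R -> R) : Prop :=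
  is_mean M /\ is_symmetric M /\ is_homogeneous M /\
  (forall x y : R, 0 < x -> 0 < y -> continuity_2d_pt M x y).

Definition is_Seiffert (f : R -> R) : Prop :=
  forall z : R, 0 < z < 1 -> z / (1 + z) <= f z <= z / (1 - z).

Definition is_continuous_Seiffert (f : R -> R) : Prop :=
  is_Seiffert f /\ (forall z : R, 0 < z < 1 -> continuous f z).

Definition Seiffert_of (M : R -> R -> R) (z : R) : R :=
  z / M (1 - z) (1 + z).

(* g = I(f) on (0,1): for every z the integral exists and has value g z.
   The value of the integrand at the endpoint 0 is irrelevant to [is_RInt]. *)
Definition is_I (f g : R -> R) : Prop :=
  forall z : R, 0 < z < 1 -> is_RInt (fun u : R => f u / u) 0 z (g z).

(* N^{t} *)
Definition contracted (N : R -> R -> R) (t x y : R) : R :=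
  N ((x + y) / 2 + t * ((x - y) / 2)) ((x + y) / 2 - t * ((x - y) / 2)).

Definition is_harmonic_representation (N M : R -> R -> R) : Prop :=
  is_continuous_mean N /\
  (forall x y : R, 0 < x -> 0 < y ->
     is_RInt (fun t : R => / contracted N t x y) 0 1 (/ M x y)).

Definition admits_harmonic_representation (M : R -> R -> R) : Prop :=
  exists N : R -> R -> R, is_harmonic_representation N M.

(* Main.v *)
(* Since [N^{t}(1-z,1+z) = N(1-tz,1+tz)], the substitution [u = t z] turns the
   harmonic representation of [M] by [N], taken at [(1-z,1+z)], into
   [m(z) = int_0^z n(u)/u du], where [n] is the Seiffert function of [N]; by
   homogeneity and symmetry this normalization loses nothing.  Conversely
   [N(x,y)] is recovered as [((x+y)/2) / g(|x-y|/(x+y))] with [g(z) = n(z)/z],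
   and the Seiffert bounds [1/(1+z) <= g(z) <= 1/(1-z)] force [g(0+) = 1], which
   gives the continuity of [N] on the diagonal. *)
Require Import Defs.
From Stdlib Require Import Reals Lra.
From Coquelicot Require Import Coquelicot.
Open Scope R_scope.

(** * Means and their Seiffert functions *)

Lemma mean_pos (M : R -> R -> R) (x y : R) :
  is_mean M -> 0 < x -> 0 < y -> 0 < M x y.
Proof.
intros HM Hx Hy.
apply Rlt_le_trans with (Rmin x y).
- now apply Rmin_glb_lt.
- now apply HM.
Qed.

(** Scaling by [2 / (x + y)] moves the pair onto the line of sum 2, where it is determined up to
    order by its relative gap; symmetry settles the order. *)
Lemma mean_normalize (M : R -> R -> R) (x y : R) :
  is_symmetric M -> is_homogeneous M -> 0 < x -> 0 < y ->
  M x y = (x + y) / 2 * M (1 - Rabs (x - y) / (x + y)) (1 + Rabs (x - y) / (x + y)).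
Proof.
intros Hs Hh.
assert (Hle : forall a b, 0 < a <= b ->
  M a b = (a + b) / 2 * M (1 - Rabs (a - b) / (a + b)) (1 + Rabs (a - b) / (a + b))).
{ intros a b Hab.
  rewrite Rabs_left1 by lra.
  replace (1 - - (a - b) / (a + b)) with (2 / (a + b) * a) by (field; lra).
  replace (1 + - (a - b) / (a + b)) with (2 / (a + b) * b) by (field; lra).
  rewrite Hh; try lra.
  - field; lra.
  - apply Rdiv_lt_0_compat; lra. }
intros Hx Hy.
destruct (Rle_dec x y) as [Hxy | Hxy].
- apply Hle; lra.
- rewrite Hs, Rabs_minus_sym, (Rplus_comm x y) by easy.
  apply Hle; lra.
Qed.

Lemma Seiffert_of_is_Seiffert (M : R -> R -> R) :
  is_mean M -> is_Seiffert (Seiffert_of M).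
Proof.
intros HM z Hz.
destruct (HM (1 - z) (1 + z)) as [Hmin Hmax]; try lra.
rewrite Rmin_left in Hmin by lra.
rewrite Rmax_right in Hmax by lra.
unfold Seiffert_of, Rdiv.
split; apply Rmult_le_compat_l; try lra; apply Rinv_le_contravar; lra.
Qed.

Lemma Seiffert_of_continuous (M : R -> R -> R) :
  is_continuous_mean M -> is_continuous_Seiffert (Seiffert_of M).
Proof.
intros (HM & _ & _ & HC).
split; [now apply Seiffert_of_is_Seiffert |].
intros z Hz.
apply (continuous_mult (fun z => z) (fun z => / M (1 - z) (1 + z))).
- apply continuous_id.
- apply continuous_Rinv_comp.
  + apply (continuous_comp_2 (fun z => 1 - z) (fun z => 1 + z) M).
    * apply @continuous_minus; [apply continuous_const | apply continuous_id].
    * apply @continuous_plus; [apply continuous_const | apply continuous_id].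
    * apply continuity_2d_pt_filterlim, HC; simpl; lra.
  + apply Rgt_not_eq, mean_pos; [easy | lra | lra].
Qed.

Lemma contracted_normalized (N : R -> R -> R) (t z : R) :
  contracted N t (1 - z) (1 + z) = N (1 - t * z) (1 + t * z).
Proof. unfold contracted; f_equal; field. Qed.

(* [n(z)/z], extended by its limit [1] at [0]. *)
Definition slope (n : R -> R) (z : R) : R :=
  if Rlt_dec 0 z then n z / z else 1.

(** For positive [z] these are the Seiffert bounds divided by [z]; at 0 both bounds equal 1, so the
    diagonal case is covered as well. *)
Lemma slope_bounds (n : R -> R) (z : R) :
  is_Seiffert n -> 0 <= z < 1 -> / (1 + z) <= slope n z <= / (1 - z).
Proof.
intros Hn Hz; unfold slope.
destruct (Rlt_dec 0 z) as [Hpos | Hneg].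
- destruct (Hn z) as [Hlo Hup]; [lra |].
  split; apply Rmult_le_reg_r with z; try easy; unfold Rdiv.
  + rewrite Rmult_assoc, Rinv_l by lra; unfold Rdiv in Hlo; lra.
  + rewrite Rmult_assoc, Rinv_l by lra; unfold Rdiv in Hup; lra.
- replace z with 0 by lra.
  rewrite Rplus_0_r, Rminus_0_r, Rinv_1; lra.
Qed.

Lemma slope_pos (n : R -> R) (z : R) :
  is_Seiffert n -> 0 <= z < 1 -> 0 < slope n z.
Proof.
intros Hn Hz.
apply Rlt_le_trans with (/ (1 + z)).
- apply Rinv_0_lt_compat; lra.
- now apply slope_bounds.
Qed.

Lemma slope_continuous_0 (n : R -> R) : is_Seiffert n -> continuous (slope n) 0.
Proof.
intros Hn.
assert (H0 : slope n 0 = 1) by (unfold slope; destruct (Rlt_dec 0 0); lra).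
unfold continuous; rewrite H0.
(* The absolute values make the two bounds valid to the left of [0] as well. *)
apply filterlim_le_le with (f := fun z => / (1 + Rabs z)) (h := fun z => / (1 - Rabs z)) (l := Finite 1).
- exists (mkposreal 1 Rlt_0_1); intros z Hz.
  change (Rabs (z - 0) < 1) in Hz; rewrite Rminus_0_r in Hz.
  assert (Hz0 := Rabs_pos z).
  destruct (Rlt_dec 0 z) as [Hpos | Hneg].
  + rewrite Rabs_pos_eq in * by lra.
    apply slope_bounds; [easy | lra].
  + unfold slope; destruct (Rlt_dec 0 z); [easy |].
    split.
    * rewrite <- Rinv_1 at 2; apply Rinv_le_contravar; lra.
    * rewrite <- Rinv_1 at 1; apply Rinv_le_contravar; lra.
(* Writing the limit 1 as the value at 0 turns the limit into continuity of the bounding function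
   there. *)
- replace (Rbar_locally 1) with (locally (/ (1 + Rabs 0)))
    by (simpl; rewrite Rabs_R0, Rplus_0_r, Rinv_1; reflexivity).
  apply (continuous_Rinv_comp (fun z => 1 + Rabs z)).
  + apply @continuous_plus; [apply continuous_const | apply continuous_Rabs].
  + rewrite Rabs_R0; lra.
- replace (Rbar_locally 1) with (locally (/ (1 - Rabs 0)))
    by (simpl; rewrite Rabs_R0, Rminus_0_r, Rinv_1; reflexivity).
  apply (continuous_Rinv_comp (fun z => 1 - Rabs z)).
  + apply @continuous_minus; [apply continuous_const | apply continuous_Rabs].
  + rewrite Rabs_R0; lra.
Qed.

Lemma slope_continuous (n : R -> R) (z : R) :
  is_continuous_Seiffert n -> 0 <= z < 1 -> continuous (slope n) z.
Proof.
intros [Hn HC] Hz.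
destruct (Rlt_dec 0 z) as [Hpos | Hneg].
- apply continuous_ext_loc with (fun u => n u * / u).
  (* Radius [z] keeps [u] positive, hence in the quotient branch of [slope]. *)
  + exists (mkposreal z Hpos); intros u Hu.
    change (Rabs (u - z) < z) in Hu; apply Rabs_def2 in Hu.
    unfold slope; destruct (Rlt_dec 0 u); [easy | lra].
  + apply (continuous_mult n Rinv).
    * apply HC; lra.
    * apply continuous_Rinv; lra.
- replace z with 0 by lra.
  now apply slope_continuous_0.
Qed.

(** * The mean attached to a Seiffert function *)

(** The inverse correspondence, with [slope] in place of [n] so that one formula also covers
    [x = y], where it gives [x]. *)
Definition mean_of_Seiffert (n : R -> R) (x y : R) : R :=
  (x + y) / 2 * / slope n (Rabs (x - y) / (x + y)).

Lemma relative_gap_bounds (x y : R) :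
  0 < x -> 0 < y -> 0 <= Rabs (x - y) / (x + y) < 1.
Proof.
intros Hx Hy; split.
- apply Rdiv_le_0_compat; [apply Rabs_pos | lra].
- apply Rlt_div_l; [lra |].
  rewrite Rmult_1_l; apply Rabs_def1; lra.
Qed.

Lemma mean_of_Seiffert_is_mean (n : R -> R) :
  is_Seiffert n -> is_mean (mean_of_Seiffert n).
Proof.
intros Hn x y Hx Hy; unfold mean_of_Seiffert.
assert (Hz := relative_gap_bounds x y Hx Hy).
assert (Hpos := slope_pos n _ Hn Hz).
destruct (slope_bounds n _ Hn Hz) as [Hlo Hup].
(* In this form the mean inequalities are the inverted bounds of [slope], times the half-sum. *)
assert (Hmin : Rmin x y = (x + y) / 2 * (1 - Rabs (x - y) / (x + y))).
{ unfold Rmin; destruct (Rle_dec x y).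
  - rewrite Rabs_left1 by lra; field; lra.
  - rewrite Rabs_pos_eq by lra; field; lra. }
assert (Hmax : Rmax x y = (x + y) / 2 * (1 + Rabs (x - y) / (x + y))).
{ unfold Rmax; destruct (Rle_dec x y).
  - rewrite Rabs_left1 by lra; field; lra.
  - rewrite Rabs_pos_eq by lra; field; lra. }
rewrite Hmin, Hmax.
set (z := Rabs (x - y) / (x + y)) in *.
split; apply Rmult_le_compat_l; try lra.
- rewrite <- (Rinv_inv (1 - z)); now apply Rinv_le_contravar.
- rewrite <- (Rinv_inv (1 + z)); apply Rinv_le_contravar; [apply Rinv_0_lt_compat; lra | easy].
Qed.

Lemma mean_of_Seiffert_symmetric (n : R -> R) : is_symmetric (mean_of_Seiffert n).
Proof.
intros x y _ _; unfold mean_of_Seiffert.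
now rewrite Rabs_minus_sym, (Rplus_comm x y).
Qed.

Lemma mean_of_Seiffert_homogeneous (n : R -> R) : is_homogeneous (mean_of_Seiffert n).
Proof.
intros l x y Hl Hx Hy; unfold mean_of_Seiffert.
replace (Rabs (l * x - l * y) / (l * x + l * y)) with (Rabs (x - y) / (x + y)).
- unfold Rdiv; ring.
- rewrite <- Rmult_minus_distr_l, Rabs_mult, (Rabs_pos_eq l) by lra.
  field; split; nra.
Qed.

Lemma mean_of_Seiffert_continuous (n : R -> R) :
  is_continuous_Seiffert n -> is_continuous_mean (mean_of_Seiffert n).
Proof.
intros Hn.
split; [apply mean_of_Seiffert_is_mean, Hn |].
split; [apply mean_of_Seiffert_symmetric |].
split; [apply mean_of_Seiffert_homogeneous |].
intros x y Hx Hy; apply continuity_2d_pt_filterlim.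
assert (Hz := relative_gap_bounds x y Hx Hy).
assert (Hsum : continuous (fun p : R * R => fst p + snd p) (x, y)).
{ apply @continuous_plus; [apply continuous_fst | apply continuous_snd]. }
apply (continuous_mult (fun p : R * R => (fst p + snd p) / 2)
  (fun p : R * R => / slope n (Rabs (fst p - snd p) / (fst p + snd p))) (x, y)).
- apply (continuous_mult (fun p : R * R => fst p + snd p) (fun _ => / 2)).
  + exact Hsum.
  + apply continuous_const.
- apply (continuous_comp
    (fun p : R * R => slope n (Rabs (fst p - snd p) / (fst p + snd p))) Rinv).
  + apply (continuous_comp (fun p : R * R => Rabs (fst p - snd p) / (fst p + snd p))).
    * apply (continuous_mult (fun p : R * R => Rabs (fst p - snd p))
        (fun p : R * R => / (fst p + snd p))).
      -- apply (continuous_comp (fun p : R * R => fst p - snd p) Rabs).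
         ++ apply @continuous_minus; [apply continuous_fst | apply continuous_snd].
         ++ apply continuous_Rabs.
      -- apply (continuous_comp (fun p : R * R => fst p + snd p) Rinv); [exact Hsum |].
         apply continuous_Rinv; simpl; lra.
    (* On the diagonal this is continuity of [slope] at 0. *)
    * now apply slope_continuous.
  + apply continuous_Rinv, Rgt_not_eq, slope_pos; [apply Hn | easy].
Qed.

(** Contraction preserves the sum of the two arguments and multiplies their difference by [t], so
    the relative gap is multiplied by [t]. *)
Lemma inv_contracted_mean_of_Seiffert (n : R -> R) (t x y : R) :
  is_Seiffert n -> 0 <= t <= 1 -> 0 < x -> 0 < y ->
  / contracted (mean_of_Seiffert n) t x y
    = 2 / (x + y) * slope n (t * (Rabs (x - y) / (x + y))).
Proof.
intros Hn Ht Hx Hy; unfold contracted, mean_of_Seiffert.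
assert (Hz := relative_gap_bounds x y Hx Hy).
replace ((x + y) / 2 + t * ((x - y) / 2) + ((x + y) / 2 - t * ((x - y) / 2)))
  with (x + y) by field.
replace ((x + y) / 2 + t * ((x - y) / 2) - ((x + y) / 2 - t * ((x - y) / 2)))
  with (t * (x - y)) by field.
rewrite Rabs_mult, (Rabs_pos_eq t) by lra.
replace (t * Rabs (x - y) / (x + y)) with (t * (Rabs (x - y) / (x + y))) by (field; lra).
assert (0 < slope n (t * (Rabs (x - y) / (x + y)))) by (apply slope_pos; [easy | nra]).
field; split; lra.
Qed.

(** * The substitution in the integral, in both directions *)

Lemma is_RInt_slope_scaled (n : R -> R) (z l : R) :
  0 < z -> is_RInt (fun u => n u / u) 0 z l ->
  is_RInt (fun t => slope n (t * z)) 0 1 (l / z).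
Proof.
intros Hz HI.
(* The inner [z] and the shift 0 match the linear change of variable; the outer [/ z] cancels the
   Jacobian. Equality is required only in the open interval, where [slope] is the quotient. *)
apply is_RInt_ext with (fun t => scal (/ z) (scal z (n (z * t + 0) / (z * t + 0)))).
{ intros t; rewrite Rmin_left, Rmax_right by lra; intros Ht.
  rewrite Rplus_0_r, (Rmult_comm z t); unfold slope.
  assert (0 < t * z) by nra.
  destruct (Rlt_dec 0 (t * z)); [| easy].
  change (/ z * (z * (n (t * z) / (t * z))) = n (t * z) / (t * z)).
  field; lra. }
replace (l / z) with (scal (/ z) l) by (apply Rmult_comm).
apply @is_RInt_scal.
apply (is_RInt_comp_lin (fun u => n u / u) z 0 0 1).
now rewrite Rmult_0_r, Rmult_1_r, !Rplus_0_r.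
Qed.

Lemma harmonic_representation_is_I (M N : R -> R -> R) :
  is_harmonic_representation N M -> is_I (Seiffert_of N) (Seiffert_of M).
Proof.
intros [(HN & _) HI] z Hz.
assert (H := HI (1 - z) (1 + z) ltac:(lra) ltac:(lra)).
(* The inner [/ z] is the Jacobian of [t = u / z]; the outer [z] is the numerator of
   [Seiffert_of M z]. *)
apply is_RInt_ext with (fun u => scal z (scal (/ z) (/ contracted N (/ z * u + 0) (1 - z) (1 + z)))).
{ intros u; rewrite Rmin_left, Rmax_right by lra; intros Hu.
  rewrite Rplus_0_r, contracted_normalized.
  replace (/ z * u * z) with u by (field; lra).
  assert (0 < N (1 - u) (1 + u)) by (apply mean_pos; [easy | lra | lra]).
  unfold Seiffert_of.
  change (z * (/ z * / N (1 - u) (1 + u)) = u / N (1 - u) (1 + u) / u).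
  field; repeat split; lra. }
change (Seiffert_of M z) with (scal z (/ M (1 - z) (1 + z))).
apply @is_RInt_scal.
apply (is_RInt_comp_lin (fun t => / contracted N t (1 - z) (1 + z)) (/ z) 0 0 z).
now rewrite Rmult_0_r, Rinv_l, !Rplus_0_r by lra.
Qed.

Lemma is_I_harmonic_representation (M : R -> R -> R) (n : R -> R) :
  is_continuous_mean M -> is_continuous_Seiffert n -> is_I n (Seiffert_of M) ->
  is_harmonic_representation (mean_of_Seiffert n) M.
Proof.
intros (HM & Hs & Hh & _) Hn HI.
split; [now apply mean_of_Seiffert_continuous |].
intros x y Hx Hy.
assert (Hz := relative_gap_bounds x y Hx Hy).
apply is_RInt_ext with
  (fun t => scal (2 / (x + y)) (slope n (t * (Rabs (x - y) / (x + y))))).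
{ intros t; rewrite Rmin_left, Rmax_right by lra; intros Ht.
  symmetry; apply inv_contracted_mean_of_Seiffert; [apply Hn | lra | easy | easy]. }
rewrite (mean_normalize M x y) by easy.
set (z := Rabs (x - y) / (x + y)) in *.
assert (HMz : 0 < M (1 - z) (1 + z)) by (apply mean_pos; [easy | lra | lra]).
replace (/ ((x + y) / 2 * M (1 - z) (1 + z)))
  with (scal (2 / (x + y)) (/ M (1 - z) (1 + z)))
  by (change (2 / (x + y) * / M (1 - z) (1 + z) = / ((x + y) / 2 * M (1 - z) (1 + z)));
      field; lra).
apply @is_RInt_scal.
destruct (Rlt_dec 0 z) as [Hpos | Hneg].
- replace (/ M (1 - z) (1 + z)) with (Seiffert_of M z / z)
    by (unfold Seiffert_of; field; lra).
  apply is_RInt_slope_scaled; [easy | apply HI; lra].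
(* The diagonal [x = y] lies outside the range of [is_I]: the integrand is constantly 1, and the
   mean bounds force [M 1 1 = 1]. *)
- replace z with 0 by lra.
  replace (/ M (1 - 0) (1 + 0)) with (scal (1 - 0) 1).
  + apply is_RInt_ext with (fun _ => 1); [| apply @is_RInt_const].
    intros t _; rewrite Rmult_0_r; unfold slope; destruct (Rlt_dec 0 0); lra.
  + destruct (HM 1 1) as [Hmin Hmax]; try lra.
    rewrite Rmin_left in Hmin by lra.
    rewrite Rmax_left in Hmax by lra.
    rewrite Rminus_0_r, Rplus_0_r.
    replace (M 1 1) with 1 by lra.
    change (1 * 1 = / 1); lra.
Qed.

Theorem theorem2p1 (M : R -> R -> R) (hM : is_continuous_mean M) :
  admits_harmonic_representation M <->
  (exists n : R -> R, is_continuous_Seiffert n /\ is_I n (Seiffert_of M)).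
Proof.
split.
- intros [N HN].
  exists (Seiffert_of N); split.
  + apply Seiffert_of_continuous, HN.
  + now apply harmonic_representation_is_I.
- intros (n & Hn & HI).
  exists (mean_of_Seiffert n).
  now apply is_I_harmonic_representation.
Qed.
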